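(* Let $D$ be a finite digraph and $\alpha=(\alpha_v)_{v\in V(D)}$ a family of mutually disjoint finite digraphs. If $D$ is kernel-perfect and each $\alpha_v$ has a semi-Grundy function, then the Cartesian product $\sigma(D,\alpha)$ has a semi-Grundy function.
   Context: All digraphs are finite. For a vertex $x$ of a digraph $D$, $\Gamma^+(x)$ denotes the set of out-neighbours of $x$. A function $s:V(D)\to\mathbb{N}$ (with $\mathbb{N}=\{0,1,2,\dots\}$) is a semi-Grundy function of $D$ if (1) whenever $s(x)=k$, every $y\in\Gamma^+(x)$ satisfies $s(y)\neq k$; and (2) whenever $s(x)=k$, $y\in\Gamma^+(x)$ and $s(y)>k$, there exists $z\in\Gamma^+(y)$ with $s(z)=k$. A set $I\subseteq V(D)$ is independent if no arc has both ends in $I$; a kernel of $D$ is an independent set $N$ such that every vertex not in $N$ has an arc to some vertex of $N$; $D$ is kernel-perfect if every induced subdigraph of $D$ has a kernel. Given a digraph $D$ and a family $\alpha=(\alpha_v)_{v\in V(D)}$ of mutually disjoint digraphs, the Cartesian product $\sigma(D,\alpha)$ is the digraph with vertex set $\bigcup_{v\in V(D)}V(\alpha_v)$ and arc set $\bigcup_{v\in V(D)}A(\alpha_v)\cup\{(x,y): x\in V(\alpha_u),\ y\in V(\alpha_v),\ (u,v)\in A(D)\}$. *)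

(* Defs.v *)
From HB Require Import structures.
From mathcomp Require Import all_boot.

Set Implicit Arguments.
Unset Strict Implicit.
Unset Printing Implicit Defensive.

(* Loops are not excluded. This is harmless: a vertex with a loop rules out
   kernel-perfectness and the existence of a semi-Grundy function. *)
Record digraph := Digraph { vertex :> finType; arc : rel vertex }.

Definition out_nbrs (D : digraph) (x : D) : {set D} := [set y | arc x y].

Definition semi_grundy (D : digraph) (s : D -> nat) : Prop :=
  (forall (x : D) (k : nat), s x = k ->
     forall y, y \in out_nbrs x -> s y <> k) /\
  (forall (x : D) (k : nat), s x = k ->
     forall y, y \in out_nbrs x -> k < s y ->
     exists2 z, z \in out_nbrs y & s z = k).

Definition has_semi_grundy (D : digraph) : Prop :=
  exists s : D -> nat, semi_grundy s.

Definition independent (D : digraph) (I : {set D}) : Prop :=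
  forall x y, arc x y -> ~ (x \in I /\ y \in I).

Definition is_kernel (D : digraph) (N : {set D}) : Prop :=
  independent N /\
  (forall x, x \notin N -> exists2 y, y \in N & arc x y).

Definition has_kernel (D : digraph) : Prop :=
  exists N : {set D}, is_kernel N.

Definition induced (D : digraph) (S : {set D}) : digraph :=
  @Digraph {x : D | x \in S} (fun x y => arc (val x) (val y)).

Definition kernel_perfect (D : digraph) : Prop :=
  forall S : {set D}, has_kernel (induced S).

(* The union of the mutually disjoint vertex sets V(alpha v) is the tagged sum
   of the types [alpha v]. [tagged_as x y] is [tagged y] seen as a vertex of
   [alpha (tag x)], which is meaningful when [tag x == tag y]. *)
Definition sigma_arc (D : digraph) (alpha : D -> digraph) :
    rel {v : D & alpha v} :=
  fun x y =>
    ((tag x == tag y) && arc (tagged x) (tagged_as x y))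
    || arc (tag x) (tag y).

Definition sigma_digraph (D : digraph) (alpha : D -> digraph) : digraph :=
  @Digraph {v : D & alpha v} (@sigma_arc D alpha).

Lemma sigma_arcP (D : digraph) (alpha : D -> digraph)
    (x y : sigma_digraph alpha) :
  arc x y <->
    (exists (v : D) (a b : alpha v),
       [/\ x = Tagged (fun v => alpha v) a,
           y = Tagged (fun v => alpha v) b & arc a b])
    \/ arc (tag x) (tag y).
Proof.
rewrite /= /sigma_arc; split.
  case/orP => [/andP[]|]; last by right.
  case: x y => [u a] [w b] /= /eqP e; subst w.
  rewrite tagged_asE => ab; left; by exists u, a, b.
case=> [[v [a [b [-> -> ab]]]]|->]; last by rewrite orbT.
by rewrite /= eqxx tagged_asE ab.
Qed.

(* Main.v *)
From mathcomp Require Import all_boot.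
Require Import Defs.

Set Implicit Arguments.
Unset Strict Implicit.
Unset Printing Implicit Defensive.

(** The least level of a semi-Grundy function is a semikernel: an independent
    set with a return arc from every out-neighbour outside it. Deleting it
    leaves a digraph on which the function is still semi-Grundy, and conversely
    a semi-Grundy function of what remains after deleting a semikernel extends
    to the whole digraph, with the semikernel as new level [0].

    In the product, take a kernel [K] of the subdigraph of [D] induced by the
    factors that still have vertices. The least levels of the factors over [K]
    together form a semikernel of what remains of the product: an arc leaving
    it stays in a factor, where the semikernel of that factor gives a return
    arc, or leads over a vertex outside [K], from which an arc returns to
    [K]. Delete it and repeat. *)

Section RelativeNotions.

Variable D : digraph.
Implicit Types (f : D -> nat) (x y z : D) (R K N : {set D}).

Definition semi_grundy_on R f : Prop :=
  forall x y, x \in R -> y \in R -> arc x y ->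
    f x <> f y /\
    (f x < f y -> exists z, [/\ z \in R, arc y z & f z = f x]).

Definition has_semi_grundy_on R : Prop := exists f, semi_grundy_on R f.

Definition kernel_in R K : Prop :=
  [/\ K \subset R, independent K &
      forall x, x \in R -> x \notin K -> exists2 y, y \in K & arc x y].

Definition semikernel_in R N : Prop :=
  [/\ N \subset R, independent N &
      forall x y, x \in N -> y \in R -> y \notin N -> arc x y ->
        exists2 z, z \in N & arc y z].

Definition least_level f R : {set D} :=
  [set x in R | [forall y in R, f x <= f y]].

Lemma semi_grundy_onT f : semi_grundy_on [set: D] f <-> semi_grundy f.
Proof.
split=> [fP | [f_neq f_back] x y _ _ xy].
  split=> x _ <- y; rewrite inE => xy.
    by have [/nesym] := fP x y (in_setT _) (in_setT _) xy.
  have [_ /[apply] -[z [_ yz fz]]] := fP x y (in_setT _) (in_setT _) xy.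
  by exists z; rewrite ?inE.
have xy_out : y \in out_nbrs x by rewrite inE.
split=> [|ltf]; first exact/nesym/(f_neq x).
have [z] := f_back x _ erefl y xy_out ltf.
by rewrite inE => yz fz; exists z.
Qed.

Lemma kernel_perfect_kernel_in : kernel_perfect D ->
  forall R, exists K, kernel_in R K.
Proof.
move=> hD R; have [K [Kind Kabs]] := hD R.
exists (val @: K); split.
- by apply/subsetP=> _ /imsetP[x _ ->]; apply: valP.
- move=> _ _ /[swap] -[/imsetP[x xK ->] /imsetP[y yK ->]] xy.
  exact: (Kind x y xy).
move=> x xR xK; have [|y yK xy] := Kabs (Sub x xR).
  by apply: contra xK => xK; apply/imsetP; exists (Sub x xR).
by exists (val y) => //; apply: imset_f.
Qed.

Lemma kernel_in_neq0 R K : kernel_in R K -> R != set0 -> K != set0.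
Proof.
case=> _ _ Kabs /set0Pn[x xR]; apply/set0Pn.
have [xK|xK] := boolP (x \in K); first by exists x.
by have [y yK _] := Kabs x xR xK; exists y.
Qed.

Lemma least_levelP f R x :
  reflect (x \in R /\ forall y, y \in R -> f x <= f y) (x \in least_level f R).
Proof. by rewrite inE; apply: (iffP andP) => -[xR /forall_inP]. Qed.

Lemma least_level_neq0 f R : R != set0 -> least_level f R != set0.
Proof.
case/set0Pn=> x0 x0R; have [x xR xmin] := arg_minnP f x0R.
by apply/set0Pn; exists x; apply/least_levelP.
Qed.

Lemma semikernel_in_least_level f R :
  semi_grundy_on R f -> semikernel_in R (least_level f R).
Proof.
move=> fP; split.
- by apply/subsetP=> x /least_levelP[].
- move=> x y xy [/least_levelP[xR xmin] /least_levelP[yR ymin]].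
  have [fxy _] := fP x y xR yR xy; apply: fxy.
  by apply/eqP; rewrite eqn_leq xmin ?ymin.
move=> x y /least_levelP[xR xmin] yR yN xy; have [_ f_back] := fP x y xR yR xy.
have [|z [zR yz fz]] := f_back.
  rewrite ltnNge; apply: contra yN => leyx; apply/least_levelP; split=> // w wR.
  exact: leq_trans leyx (xmin w wR).
by exists z => //; apply/least_levelP; rewrite fz.
Qed.

Lemma semi_grundy_onD_least_level f R :
  semi_grundy_on R f -> semi_grundy_on (R :\: least_level f R) f.
Proof.
move=> fP x y /setDP[xR xN] /setDP[yR _] xy.
have [fxy f_back] := fP x y xR yR xy; split=> // /f_back[z [zR yz fz]].
exists z; split=> //; rewrite in_setD zR andbT.
by apply: contra xN => /least_levelP[_]; rewrite fz => xmin; apply/least_levelP.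
Qed.

Lemma has_semi_grundy_on_semikernel R N : semikernel_in R N ->
  has_semi_grundy_on (R :\: N) -> has_semi_grundy_on R.
Proof.
case=> /subsetP sNR Nind Nback [f fP].
exists (fun x => if x \in N then 0 else (f x).+1) => x y xR yR xy.
case: (boolP (x \in N)) (boolP (y \in N)) => [xN|xN] [yN|yN] //.
- by case: (Nind x y xy).
- split=> // _; have [z zN yz] := Nback x y xN yR yN xy.
  by exists z; rewrite zN sNR.
have [||fxy f_back] := fP x y _ _ xy; rewrite ?inE ?xN ?yN //.
split=> [[]//|/f_back[z [/setDP[zR zN] yz fz]]].
by exists z; rewrite (negbTE zN) fz.
Qed.

Lemma has_semi_grundy_on_peel (P : {set D} -> Prop) :
    (forall R, P R -> R != set0 ->
       exists N, [/\ semikernel_in R N, N != set0 & P (R :\: N)]) ->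
  forall R, P R -> has_semi_grundy_on R.
Proof.
move=> peel R; have [n] := ubnP #|R|; elim: n R => // n IHn R leRn PR.
have [->|R0] := eqVneq R set0; first by exists (fun=> 0) => x y; rewrite inE.
have [N [NP N0 PRN]] := peel R PR R0.
apply: (has_semi_grundy_on_semikernel NP); apply: IHn PRN.
have [sNR _ _] := NP; apply: leq_trans (leRn : #|R| <= n).
by rewrite cardsD (setIidPr sNR) ltn_subrL !card_gt0 N0.
Qed.

End RelativeNotions.

Section Sigma.

Variables (D : digraph) (alpha : D -> digraph).
Implicit Types (R : {set sigma_digraph alpha}) (K : {set D}).
Implicit Types (N : forall v, {set alpha v}).

Definition fibre R v : {set alpha v} := Tagged (fun v => alpha v) @^-1: R.

Definition sigma_set K N : {set sigma_digraph alpha} :=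
  [set x | (tag x \in K) && (tagged x \in N (tag x))].

Lemma fibreD_sigma_set R K N v :
  fibre (R :\: sigma_set K N) v =
  if v \in K then fibre R v :\: N v else fibre R v.
Proof. by apply/setP=> a; case: ifP => vK; rewrite !inE /= vK. Qed.

Lemma fibre_neq0 R v : (fibre R v != set0) = (v \in tag @: R).
Proof.
apply/set0Pn/imsetP=> [[a]|[[w a] aR ->]]; last by exists a; rewrite inE.
by rewrite inE => aR; exists (Tagged (fun v => alpha v) a).
Qed.

Lemma sigma_set_over K N v : v \in K -> N v != set0 ->
  exists2 x, x \in sigma_set K N & tag x = v.
Proof.
move=> vK /set0Pn[a aN].
by exists (Tagged (fun v => alpha v) a); rewrite // inE vK.
Qed.

Lemma sigma_set_neq0 K N :
  K != set0 -> (forall v, v \in K -> N v != set0) -> sigma_set K N != set0.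
Proof.
case/set0Pn=> v vK N0; have [x xN _] := sigma_set_over vK (N0 v vK).
by apply/set0Pn; exists x.
Qed.

Lemma semikernel_in_sigma_set R K N :
    kernel_in (tag @: R) K ->
    (forall v, v \in K -> semikernel_in (fibre R v) (N v)) ->
    (forall v, v \in K -> N v != set0) ->
  semikernel_in R (sigma_set K N).
Proof.
case=> _ Kind Kabs NP N0; split.
- apply/subsetP=> -[v a]; rewrite inE => /andP[/= vK aN].
  by have [/subsetP/(_ a aN)] := NP v vK; rewrite inE.
- move=> x y /sigma_arcP[[v [a [b [-> -> ab]]]]|xy]; rewrite !inE /=.
    case=> /andP[vK aN] /andP[_ bN].
    by have [_ Nind _] := NP v vK; apply: Nind ab _.
  by case=> /andP[xK _] /andP[yK _]; apply: Kind xy _.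
move=> x y xN yR yN /sigma_arcP[[v [a [b [xE yE ab]]]]|xy].
  move: xN yR yN; rewrite {x}xE {y}yE !inE /= => /andP[vK aN] bR.
  rewrite vK /= => bN; have [_ _ Nback] := NP v vK.
  have [|c cN bc] := Nback a b aN _ bN ab; first by rewrite inE.
  exists (Tagged (fun v => alpha v) c); first by rewrite inE vK.
  by apply/sigma_arcP; left; exists v, b, c.
have xK : tag x \in K by move: xN; rewrite inE => /andP[].
have yK : tag y \notin K by apply/negP=> yK; apply: Kind xy _.
have [w wK yw] := Kabs _ (imset_f _ yR) yK.
have [z zN zw] := sigma_set_over wK (N0 w wK).
by exists z => //; apply/sigma_arcP; right; rewrite zw.
Qed.

Lemma has_semi_grundy_on_sigma (s : forall v, alpha v -> nat) R :
    kernel_perfect D -> (forall v, semi_grundy_on (fibre R v) (@s v)) ->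
  has_semi_grundy_on R.
Proof.
move=> hD; pose P R := forall v, semi_grundy_on (fibre R v) (@s v).
move: R; apply: (has_semi_grundy_on_peel (P := P)) => R sP R0.
have [K KP] := kernel_perfect_kernel_in hD (tag @: R).
pose N v := least_level (@s v) (fibre R v).
have N0 v : v \in K -> N v != set0.
  case: KP => /subsetP sKR _ _ /sKR; rewrite -fibre_neq0.
  exact: least_level_neq0.
exists (sigma_set K N); split.
- by apply: semikernel_in_sigma_set => // v _; apply: semikernel_in_least_level.
- by apply: sigma_set_neq0 N0; apply: kernel_in_neq0 KP _; rewrite imset_eq0.
move=> v; rewrite fibreD_sigma_set; case: ifP => // _.
exact: semi_grundy_onD_least_level.
Qed.

End Sigma.

Theorem theorem5 (D : digraph) (alpha : D -> digraph)
    (hD : kernel_perfect D)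
    (halpha : forall v : D, has_semi_grundy (alpha v)) :
  has_semi_grundy (sigma_digraph alpha).
Proof.
have [s sP] := fin_all_exists halpha.
have sPT v : semi_grundy_on (fibre [set: sigma_digraph alpha] v) (s v).
  by rewrite /fibre preimsetT; apply/semi_grundy_onT.
have [f fP] := has_semi_grundy_on_sigma hD sPT.
by exists f; apply/semi_grundy_onT.
Qed.
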